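(* There is a numerical constant $c>0$ such that the following holds. Let $\ell$ be the squared loss $\ell(x,y)=(x-y)^2$ on $\mathcal{X}=\mathcal{Y}=[0,1]$. Consider the game protocol $(p,m,\mathrm{IC})$ described in the context with $K$ experts and horizon $T$, with $m\ge2$, $p\ge2$ and $\mathrm{IC}\in\{\mathrm{False},\mathrm{True}\}$. Then the expected regret satisfies $$\inf\sup\mathbb{E}[\mathcal{R}_T]\ge c\,\frac{K}{m},$$ where the infimum is over all playing strategies and the supremum is over all individual sequences.
   Context: Write $[n]=\{1,\dots,n\}$. Game protocol $(p,m,\mathrm{IC})$ with $K$ experts and horizon $T$, where $p,m\in[K]$, and $p\le m$ if $\mathrm{IC}=\mathrm{True}$. An individual sequence consists of fixed outcomes $y_t\in\mathcal{Y}$ and expert predictions $F_{i,t}\in\mathcal{X}$, $i\in[K]$, $t\in[T]$, unknown to the learner. At each round $t=1,\dots,T$: (1) the learner chooses $S_t\subseteq[K]$ with $|S_t|=p$ and convex combination weights $(\alpha_{i,t})_{i\in S_t}$ ($\alpha_{i,t}\ge0$, $\sum_{i\in S_t}\alpha_{i,t}=1$); (2) the learner plays $z_t=\sum_{i\in S_t}\alpha_{i,t}F_{i,t}$ and incurs the loss $\ell(z_t,y_t)$; (3) the learner chooses $C_t\subseteq[K]$ with $|C_t|=m$, and with $S_t\subseteq C_t$ if $\mathrm{IC}=\mathrm{True}$ (no inclusion is required if $\mathrm{IC}=\mathrm{False}$); (4) the losses $\ell(F_{i,t},y_t)$, $i\in C_t$, are revealed to the learner. A playing strategy determines the learner's choices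 from its past observations (the sets and losses revealed so far) and possibly internal randomization. The regret is $\mathcal{R}_T=\sum_{t=1}^T\ell(z_t,y_t)-\min_{i\in[K]}\sum_{t=1}^T\ell(F_{i,t},y_t)$, and $\mathbb{E}$ is the expectation over the learner's randomization.
   Formalization: The formal theorem adds the assumption that the horizon satisfies T ≥ K/m; without a condition of this kind the claim fails, since the regret is at most T (take T = 1, m = p = 2 and K > 2/c). *)

(* Defs.v *)
From HB Require Import structures.
From mathcomp Require Import all_boot all_order all_algebra.
From mathcomp Require Import all_classical all_reals all_analysis.

Set Implicit Arguments.
Unset Strict Implicit.
Unset Printing Implicit Defensive.

Import Order.TTheory GRing.Theory Num.Theory.
Import numFieldNormedType.Exports.

Local Open Scope classical_set_scope.
Local Open Scope ring_scope.

Definition squared_loss (R : realType) (x y : R) : R := (x - y) ^+ 2.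

(* What the learner remembers of one round: the played set S_t, the observed
   set C_t, and the revealed losses, revealed i being Some loss exactly when
   i \in C_t.  The incurred loss and the predictions are not revealed. *)
Record observation (R : realType) (K : nat) := Observation {
  obs_played : {set 'I_K};
  obs_observed : {set 'I_K};
  obs_revealed : {ffun 'I_K -> option R}
}.

(* A randomized strategy draws omega from an arbitrary probability space once
   and for all, then reacts deterministically to the past observations, listed
   from oldest to newest; the index of the current round is the length of that
   list.  Measurability is only required in omega, for each fixed past: along a
   given individual sequence only finitely many pasts can occur, so this makes
   the regret a random variable. *)
Record strategy (R : realType) (K p m : nat) (IC : bool) := Strategy {
  st_display : measure_display;
  st_space : measurableType st_display;
  st_law : probability st_space R;
  play : st_space -> seq (observation R K) -> {set 'I_K};
  weight : st_space -> seq (observation R K) -> 'I_K -> R;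
  observe : st_space -> seq (observation R K) -> {set 'I_K};
  card_play : forall w h, #|play w h| = p;
  weight_ge0 : forall w h i, i \in play w h -> 0 <= weight w h i;
  weight_sum1 : forall w h, \sum_(i in play w h) weight w h i = 1;
  card_observe : forall w h, #|observe w h| = m;
  play_sub_observe : forall w h, IC -> play w h \subset observe w h;
  measurable_play : forall h A, measurable [set w | play w h = A];
  measurable_weight : forall h i, measurable_fun setT (fun w => weight w h i);
  measurable_observe : forall h A, measurable [set w | observe w h = A]
}.

(* Rounds are numbered 0, ..., T - 1; values at indices t >= T are
   unconstrained and never used. *)
Record individual_sequence (R : realType) (X Y : set R) (K T : nat) :=
  IndividualSequence {
  outcome : nat -> R;
  prediction : 'I_K -> nat -> R;
  outcome_in : forall t, (t < T)%N -> Y (outcome t);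
  prediction_in : forall i t, (t < T)%N -> X (prediction i t)
}.

Section Game.
Context (R : realType) (ell : R -> R -> R) (X Y : set R).
Context (K T p m : nat) (IC : bool).
Implicit Types (s : strategy R K p m IC) (e : individual_sequence X Y K T).

Definition expert_loss e (i : 'I_K) (t : nat) : R :=
  ell (prediction e i t) (outcome e t).

Definition observe_round s e (w : st_space s) (h : seq (observation R K))
    (t : nat) : observation R K :=
  Observation (play w h) (observe w h)
    [ffun i => if i \in observe w h then Some (expert_loss e i t) else None].

Fixpoint history s e (w : st_space s) (t : nat) : seq (observation R K) :=
  if t is t'.+1 then
    rcons (history e w t') (observe_round e w (history e w t') t')
  else [::].

Definition learner_prediction s e (w : st_space s) (t : nat) : R :=
  \sum_(i in play w (history e w t))
    weight w (history e w t) i * prediction e i t.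

(* The infimum over the experts is the minimum, as there are finitely many. *)
Definition regret s e (w : st_space s) : R :=
  \sum_(t < T) ell (learner_prediction e w t) (outcome e t)
  - inf (range (fun i : 'I_K => \sum_(t < T) expert_loss e i t)).

Definition expected_regret s e : \bar R := expectation (st_law s) (@regret s e).

Definition worst_case_regret s : \bar R :=
  ereal_sup (range (fun e => expected_regret s e)).

(* When losses lie in [0, 1] this is at most T, so a lower bound of order K / m
   is only meaningful for T of order at least K / m. *)
Definition minimax_regret : \bar R :=
  ereal_inf [set v | exists s, v = worst_case_regret s].

End Game.

(* Main.v *)
Require Import Defs.
From HB Require Import structures.
From mathcomp Require Import all_boot all_order all_algebra.
From mathcomp Require Import all_classical all_reals all_analysis.
From mathcomp Require Import measurable_realfun lra zify.

Import Order.TTheory GRing.Theory Num.Theory.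
Import numFieldNormedType.Exports.

Local Open Scope classical_set_scope.
Local Open Scope ring_scope.

(** Why the bound holds.  All outcomes are 0 and every expert predicts 1, except
    one planted expert who predicts 0 and so never errs; the minimal cumulative
    loss is then 0 and the regret is the learner's own loss.  The revealed
    losses say nothing about the identity of the planted expert until it is
    observed: up to that round, the learner acts exactly as in the null
    environment, where nobody is planted ([planted_historyE]).  Since at most m
    experts are observed per round, at least K - t * m positions of the planted
    expert are still hidden at the beginning of round t.

    The learner cannot put large weight on all hidden positions.  With weight
    a on the planted expert its loss is (1 - a)^2 >= 3/4 - a, and the weights
    sum to 1, so the losses at round t, summed over all positions, are at least
    3/4 * (K - t * m) - 1 ([sum_planted_loss]).  This is at least K / 8 as long
    as 6 * t * m <= K, hence during the first K / (6 * m) rounds at least, and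
    T >= K / m leaves room for all of them.  Summing over these rounds gives
    regrets whose average over the K positions is at least K / (48 * m)
    ([sum_regret_planted]), for each fixed value of the randomization.

    Integrating over the randomization, some position has expected regret at
    least that average.  Exchanging the average and the expectation uses that
    the regret is a random variable; since a strategy is measurable for
    each fixed past only, this comes from the finiteness of the learner's
    choices of sets ([measurable_fun_history]). *)

(** * Measurability of the regret *)

Lemma measurable_fun_finite_selection d d' (W : measurableType d)
    (V : measurableType d') (U : finType) (X : W -> U) (G : U -> W -> V) :
  (forall u, measurable [set w | X w = u]) ->
  (forall u, measurable_fun setT (G u)) ->
  measurable_fun setT (fun w => G (X w) w).
Proof.
move=> mX mG _ B mB; rewrite setTI.
have -> : (fun w => G (X w) w) @^-1` B =
    \bigcup_u ([set w | X w = u] `&` (G u @^-1` B)).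
  apply/seteqP; split => [w Bw|w [u _ [/= <-]]] //.
  by exists (X w).
apply: countable_bigcupT_measurable => [|u].
  exact/finite_set_countable/finite_finset.
by apply: measurableI => //; rewrite -[X in measurable X]setTI; exact: mG.
Qed.

Section Measurability.
Context {R : realType} {ell : R -> R -> R} {X Y : set R}.
Context {K T p m : nat} {IC : bool}.
Variables (s : strategy R K p m IC) (e : individual_sequence X Y K T).

(** The statement is over all [f] so that the last round can be absorbed
    into [f]: the past after t + 1 rounds is the past after t rounds extended by
    a record that depends on the randomization only through two sets, which take
    finitely many values. *)
Lemma measurable_fun_history d (V : measurableType d)
    (f : st_space s -> seq (observation R K) -> V) t :
  (forall h, measurable_fun setT (f^~ h)) ->
  measurable_fun setT (fun w => f w (history ell e w t)).
Proof.
elim: t f => [|t IHt] f mf /=; first exact: mf.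
pose reveal (B : {set _}) := [ffun i : 'I_K =>
  if i \in B then Some (expert_loss ell e i t) else None].
apply: (IHt (fun w h => f w (rcons h (observe_round ell e w h t)))) => h.
apply: (@measurable_fun_finite_selection _ _ _ _ _ (fun w => play (s := s) w h)
  (fun A w => f w (rcons h (Observation A (observe w h)
    (reveal (observe w h)))))) => [A|A].
  exact: measurable_play.
apply: (@measurable_fun_finite_selection _ _ _ _ _ (fun w => observe (s := s) w h)
  (fun B w => f w (rcons h (Observation A B (reveal B))))) => [B|B].
  exact: measurable_observe.
exact: mf.
Qed.

Lemma measurable_learner_prediction t :
  measurable_fun setT (fun w : st_space s => learner_prediction ell e w t).
Proof.
pose f w h := \sum_(i in play w h) weight (s := s) w h i * prediction e i t.
apply: (@measurable_fun_history _ _ f) => h.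
apply: (@measurable_fun_finite_selection _ _ _ _ _ (fun w => play (s := s) w h)
  (fun A w => \sum_(i in A) weight (s := s) w h i * prediction e i t)) => A.
  exact: measurable_play.
rewrite (_ : (fun w => _) = fun w => \sum_(i <- enum A)
    weight (s := s) w h i * prediction e i t); last first.
  by apply/funext => w; rewrite big_enum.
apply: measurable_sum => i; apply: measurable_funM => //.
exact: measurable_weight.
Qed.

End Measurability.

Lemma measurable_regret (R : realType) (X Y : set R) (K T p m : nat)
    (IC : bool) (s : strategy R K p m IC) (e : individual_sequence X Y K T) :
  measurable_fun setT (fun w : st_space s => regret (@squared_loss R) e w).
Proof.
apply: measurable_funB => //.
apply: measurable_sum => t; rewrite /squared_loss.
apply: measurable_funX; apply: measurable_funB => //.
exact: measurable_learner_prediction.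
Qed.

(** * One planted good expert among identical bad ones *)

Section PlantedExpert.
Set Implicit Arguments.
Unset Strict Implicit.
Context {R : realType} {K T p m : nat} {IC : bool}.
Implicit Types (i j : 'I_K) (o : option 'I_K) (s : strategy R K p m IC).

Lemma planted_outcome_in t : (t < T)%N -> `[0%R, 1%R]%classic (0 : R).
Proof. by move=> _; rewrite /= in_itv /= lexx ler01. Qed.

Lemma planted_prediction_in o i t : (t < T)%N ->
  `[0%R, 1%R]%classic ((Some i != o)%:R : R).
Proof. by move=> _; rewrite /= in_itv /=; case: (_ != _); rewrite lexx ler01. Qed.

(** [planted None] is the null environment, in which no expert is good. *)
Definition planted o : individual_sequence (`[0%R, 1%R] : set R) `[0%R, 1%R] K T :=
  IndividualSequence (outcome := fun=> 0)
    (prediction := fun j _ => (Some j != o)%:R)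
    planted_outcome_in (planted_prediction_in o).

Local Notation null_history := (history (@squared_loss R) (planted None)).
Local Notation planted_history i := (history (@squared_loss R) (planted (Some i))).

Lemma expert_loss_planted o i t :
  expert_loss (@squared_loss R) (planted o) i t = (Some i != o)%:R.
Proof.
rewrite /expert_loss /squared_loss /= subr0.
by case: (_ != _); rewrite ?expr1n ?expr0n.
Qed.

Definition null_observed s (w : st_space s) t : {set 'I_K} :=
  \bigcup_(r < t) observe w (null_history w r).

(** The learner sees no difference with the null environment before it observes
    the planted expert, because all the other experts suffer the same losses in
    both. *)
Lemma planted_historyE s (w : st_space s) i t :
  i \notin null_observed w t -> planted_history i w t = null_history w t.
Proof.
elim: t => // t IHt; rewrite /null_observed big_ord_recr /= finset.in_setU negb_or.
move=> /andP[/IHt -> iNobs]; congr (rcons _ (Observation _ _ _)).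
apply/ffunP => j; rewrite !ffunE; case: ifP => // jobs.
rewrite !expert_loss_planted; congr (Some (nat_of_bool _)%:R).
by apply/eqP => -[eji]; move: iNobs; rewrite -eji jobs.
Qed.

Lemma card_null_observed s (w : st_space s) t : (#|null_observed w t| <= t * m)%N.
Proof.
elim: t => [|t IHt]; first by rewrite /null_observed big_ord0 cards0.
rewrite /null_observed big_ord_recr /= mulSn addnC.
by apply: leq_trans (leq_card_setU _ _) _; rewrite card_observe leq_add2r.
Qed.

(** Extended by 0 outside the played set, where a strategy may assign arbitrary
    weights. *)
Definition null_weight s (w : st_space s) t i : R :=
  if i \in play w (null_history w t) then weight w (null_history w t) i else 0.

Lemma null_weight_ge0 s (w : st_space s) t i : 0 <= null_weight w t i.
Proof. by rewrite /null_weight; case: ifP => // /weight_ge0. Qed.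

Lemma sum_null_weight s (w : st_space s) t : \sum_i null_weight w t i = 1.
Proof. by rewrite -big_mkcond weight_sum1. Qed.

Lemma learner_prediction_planted s (w : st_space s) i t :
  i \notin null_observed w t ->
  learner_prediction (@squared_loss R) (planted (Some i)) w t
  = 1 - null_weight w t i.
Proof.
move=> iNobs; rewrite /learner_prediction planted_historyE //.
transitivity (\sum_j null_weight w t j - null_weight w t i); last first.
  by rewrite sum_null_weight.
rewrite [X in _ = X - _](bigD1 i) //= addrAC subrr add0r.
rewrite big_mkcond [LHS](bigD1 i) //= eqxx mulr0 if_same add0r.
apply: eq_bigr => j ji; rewrite /null_weight.
by rewrite (_ : Some j != Some i) // mulr1.
Qed.

(** Only the positions still hidden at round t are counted: for those the learner
    plays as in the null environment, with one and the same weight vector, of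
    total mass 1. *)
Lemma sum_planted_loss s (w : st_space s) t :
  3 / 4 * (K%:R - (t * m)%:R) - 1 <=
  \sum_i squared_loss
    (learner_prediction (@squared_loss R) (planted (Some i)) w t) 0.
Proof.
pose O := null_observed w t.
have loss_ge i : i \notin O -> 3 / 4 - null_weight w t i <=
    squared_loss (learner_prediction (@squared_loss R) (planted (Some i)) w t) 0.
  move=> /learner_prediction_planted ->; rewrite /squared_loss.
  (* (1 - a)^2 >= 3/4 - a is (a - 1/2)^2 >= 0. *)
  by have := sqr_ge0 (null_weight w t i - 1 / 2); nra.
rewrite (bigID (mem O)) /= ler_wpDl ?sumr_ge0 // => [i _|]; first exact: sqr_ge0.
apply: le_trans (ler_sum _ loss_ge).
rewrite big_split /= sumr_const sumrN lerD //.
  rewrite -[leRHS]mulr_natr ler_wpM2l //.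
  rewrite lerBlDr -natrD ler_nat.
  have /= := cardC (mem O); rewrite card_ord addnC => cardOC.
  rewrite -[leqLHS]cardOC leq_add2l.
  exact: card_null_observed.
rewrite lerN2 -(sum_null_weight w t) [leRHS](bigID (mem O)) /=.
by rewrite ler_wpDl // sumr_ge0 // => i _; exact: null_weight_ge0.
Qed.

(** The planted expert suffers no loss, so the benchmark is at most 0. *)
Lemma regret_planted_ge s (w : st_space s) i :
  \sum_(t < T) squared_loss
    (learner_prediction (@squared_loss R) (planted (Some i)) w t) 0
  <= regret (@squared_loss R) (planted (Some i)) w.
Proof.
rewrite /regret lerBrDr gerDl; apply: ge_inf.
  exists 0 => _ [j _ <-]; apply: sumr_ge0 => t _.
  by rewrite expert_loss_planted.
exists i => //; apply: big1 => t _.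
by rewrite expert_loss_planted eqxx.
Qed.

Lemma regret_planted_ge0 s (w : st_space s) i :
  0 <= regret (@squared_loss R) (planted (Some i)) w.
Proof.
apply: le_trans (regret_planted_ge w i).
by apply: sumr_ge0 => t _; exact: sqr_ge0.
Qed.

(** This holds for each value of the randomization.  The constant is
    48 = 6 * 8: the argument uses more than K / (6 * m) rounds, and each adds at
    least K / 8 to the sum. *)
Lemma sum_regret_planted s (w : st_space s) :
  (2 <= K)%N -> (0 < m)%N -> K%:R / m%:R <= T%:R :> R ->
  K%:R * (48^-1 * (K%:R / m%:R)) <=
  \sum_i regret (@squared_loss R) (planted (Some i)) w.
Proof.
move=> K2 m0 KmT.
have m0R : 0 < m%:R :> R by rewrite ltr0n.
have KR2 : 2 <= K%:R :> R by rewrite ler_nat.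
(* N is the number of t with 6 * t * m <= K, that is of rounds before which at
   most a sixth of the experts have been observed; it is at least 1, which
   matters when m is of order K. *)
pose N := (K %/ (6 * m)).+1.
have NT : (N <= T)%N.
  move: KmT; rewrite ler_pdivrMr // -natrM ler_nat /N => KTm.
  rewrite ltn_divLR; last by lia.
  by nia.
have loss_ge t : (t < N)%N -> K%:R / 8 <=
  \sum_i squared_loss
    (learner_prediction (@squared_loss R) (planted (Some i)) w t) 0.
  rewrite /N ltnS leq_divRL; last by lia.
  move=> tK; apply: le_trans (sum_planted_loss w t).
  (* 3/4 * (K - K / 6) - 1 = 5/8 * K - 1 >= K / 8 because K >= 2. *)
  have : (6 * (t * m))%:R <= K%:R :> R by rewrite ler_nat; lia.
  by rewrite natrM; lra.
apply: (@le_trans _ _ (N%:R * (K%:R / 8))).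
  have : K%:R <= N%:R * (6 * m%:R) :> R.
    rewrite -!natrM ler_nat ltnW // /N.
    by apply: ltn_ceil; lia.
  rewrite -ler_pdivrMr ?mulr_gt0 // invfM mulrCA => KN.
  have := ler_wpM2r (_ : 0 <= K%:R / 8) KN.
  by rewrite divr_ge0 // => /(_ isT); lra.
apply: le_trans (ler_sum _ (fun i _ => regret_planted_ge w i)).
rewrite exchange_big /=.
apply: (@le_trans _ _ (\sum_(t < T | (t < N)%N) K%:R / 8)).
  rewrite (big_ord_narrow NT) /= sumr_const card_ord.
  by rewrite -[leRHS]mulr_natl.
rewrite [leRHS](bigID (fun t : 'I_T => (t < N)%N)) /= ler_wpDr //.
  by apply: sumr_ge0 => t _; apply: sumr_ge0 => i _; exact: sqr_ge0.
by apply: ler_sum => t /loss_ge.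
Qed.

Lemma sum_expected_regret_planted s :
  (2 <= K)%N -> (0 < m)%N -> K%:R / m%:R <= T%:R :> R ->
  ((K%:R * (48^-1 * (K%:R / m%:R)))%:E <=
  \sum_i expected_regret (@squared_loss R) s (planted (Some i)))%E.
Proof.
move=> K2 m0 KmT.
pose r i w := regret (@squared_loss R) (s := s) (planted (Some i)) w.
have mr i : measurable_fun setT (fun w => (r i w)%:E).
  by apply/measurable_EFinP; exact: measurable_regret.
rewrite (eq_bigr (fun i => (\int[st_law s]_w (r i w)%:E)%E)); last first.
  by move=> i _; rewrite /expected_regret unlock.
rewrite -(ge0_integral_sum (st_law s) measurableT mr); last first.
  by move=> i w _; rewrite lee_fin regret_planted_ge0.
set b := _ * (_ * _).
have <- : (\int[st_law s]_w b%:E = b%:E)%E.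
  by rewrite -[RHS](expectation_cst (st_law s)) unlock.
apply: ge0_le_integral => //.
- by move=> w _; rewrite lee_fin /b !mulr_ge0 // invr_ge0.
- exact: emeasurable_sum.
- by move=> w _; rewrite sumEFin lee_fin; exact: sum_regret_planted.
Qed.

End PlantedExpert.

(** * From the average over positions to the supremum *)

Lemma average_le_ereal_sup (R : realType) (S : set \bar R) (K : nat)
    (f : 'I_K -> \bar R) (x : R) :
  (0 < K)%N -> (forall i, 0 <= f i)%E -> (forall i, S (f i)) ->
  ((K%:R * x)%:E <= \sum_i f i)%E -> (x%:E <= ereal_sup S)%E.
Proof.
move=> K0 f0 Sf xf; have fS i : (f i <= ereal_sup S)%E by exact: ereal_sup_ubound.
have := le_trans (f0 (Ordinal K0)) (fS _).
case: (ereal_sup S) fS => [y fy _|_ _|//]; last by rewrite leey.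
have := le_trans xf (lee_sum _ (fun i _ => fy i)).
rewrite sumEFin sumr_const card_ord -[y *+ K]mulr_natl !lee_fin.
by rewrite ler_pM2l // ltr0n.
Qed.

Theorem theorem5p1 (R : realType) :
  exists c : R, 0 < c /\
    forall (K T p m : nat) (IC : bool),
      (2 <= p <= K)%N -> (2 <= m <= K)%N -> (IC -> (p <= m)%N) ->
      K%:R / m%:R <= T%:R :> R ->
      ((c * (K%:R / m%:R))%:E <=
        minimax_regret (@squared_loss R) `[0%R, 1%R] `[0%R, 1%R] K T p m IC)%E.
Proof.
exists 48^-1; split; first by rewrite invr_gt0.
move=> K T p m IC /andP[p2 pK] /andP[m2 mK] _ KmT.
apply: le_ereal_inf_tmp => _ [s ->].
apply: (@average_le_ereal_sup _ _ K
  (fun i => expected_regret (@squared_loss R) s (planted (T := T) (Some i)))).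
- by lia.
- by move=> i; apply: expectation_ge0 => w; exact: regret_planted_ge0.
- by move=> i; exists (planted (Some i)).
- by apply: sum_expected_regret_planted => //; lia.
Qed.
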